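(* There exists no ring $R$ such that $\mathbb{AG}(R)\cong K_n(2)$ for any (finite or infinite) cardinal $n\geq 3$.
   Context: All rings are commutative with identity. The annihilating-ideal graph $\mathbb{AG}(R)$ of a ring $R$ is the simple graph whose vertices are the nonzero ideals $I$ of $R$ for which there exists a nonzero ideal $J$ of $R$ with $IJ=0$; distinct vertices $I,J$ are adjacent iff $IJ=0$. For a cardinal $n\ge 2$, $K_n(2)$ denotes a graph consisting of a complete graph $K_n$ on $n$ vertices together with $2$ horns attached to two distinct vertices of $K_n$; here a horn attached to a vertex $a$ is a nonempty set (of arbitrary, finite or infinite, cardinality) of new vertices of degree $1$, each adjacent only to $a$. The sizes of the horns are arbitrary and not recorded in the notation. *)

(* Defs.v *)
From mathcomp Require Import all_boot all_algebra all_classical.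

Set Implicit Arguments.
Unset Strict Implicit.
Unset Printing Implicit Defensive.

Import GRing.Theory.
Local Open Scope classical_set_scope.
Local Open Scope ring_scope.

(* Simple graphs with an arbitrary, possibly infinite, type of vertices. *)
Record sgraph := SGraph {
  vertex :> Type;
  adj : vertex -> vertex -> Prop;
  adj_sym : forall u v, adj u v -> adj v u;
  adj_irrefl : forall u, ~ adj u u
}.

Definition graph_iso (G H : sgraph) : Prop :=
  exists2 f : G -> H, bijective f & forall u v, adj u v <-> adj (f u) (f v).

Section Horns.

Definition complete_adj (N : Type) (u v : N) : Prop := u <> v.

Fact complete_adj_sym N (u v : N) : complete_adj u v -> complete_adj v u.
Proof. by move=> uv vu; apply: uv. Qed.

Fact complete_adj_irrefl N (u : N) : ~ complete_adj u u.
Proof. by apply. Qed.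

Definition complete_graph (N : Type) : sgraph :=
  SGraph (@complete_adj_sym N) (@complete_adj_irrefl N).

Variables (G : sgraph) (a : G) (H : Type).

Definition horn_adj (u v : G + H) : Prop :=
  match u, v with
  | inl x, inl y => adj x y
  | inl x, inr _ => x = a
  | inr _, inl y => y = a
  | inr _, inr _ => False
  end.

Fact horn_adj_sym u v : horn_adj u v -> horn_adj v u.
Proof. by case: u v => [x|h] [y|k] //=; apply: adj_sym. Qed.

Fact horn_adj_irrefl u : ~ horn_adj u u.
Proof. by case: u => [x|h] //=; apply: adj_irrefl. Qed.

Definition attach_horn : sgraph := SGraph horn_adj_sym horn_adj_irrefl.

End Horns.

(* [is_complete_2horns N G] : G is a K_n(2), where the cardinal n is given by
   a type N of that cardinality. *)
Definition is_complete_2horns (N : Type) (G : sgraph) : Prop :=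
  exists (a b : N) (H1 H2 : Type),
    [/\ a <> b, inhabited H1, inhabited H2 &
        graph_iso G
          (@attach_horn (@attach_horn (complete_graph N) a H1) (inl b) H2)].

Section AnnihilatingIdealGraph.

(* comPzRingType includes the zero ring. *)
Variable R : comPzRingType.

(* Unlike [idealr_closed] of ring_quotient, this allows improper ideals and
   sets without a boolean membership test. *)
Definition is_ideal (I : set R) : Prop :=
  [/\ I 0,
      forall x y, I x -> I y -> I (x + y) &
      forall r x, I x -> I (r * x)].

Definition nonzero_ideal (I : set R) : Prop := is_ideal I /\ I <> [set 0].

Definition ideal_mul (I J : set R) : set R :=
  [set x | exists (n : nat) (u v : 'I_n -> R),
     [/\ forall i, I (u i), forall i, J (v i) & x = \sum_(i < n) u i * v i]].

Definition ag_vertex : Type :=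
  {I : set R | nonzero_ideal I /\
     exists J : set R, nonzero_ideal J /\ ideal_mul I J = [set 0]}.

Definition ag_adj (I J : ag_vertex) : Prop :=
  I <> J /\ ideal_mul (sval I) (sval J) = [set 0].

Fact ideal_mulC (I J : set R) : ideal_mul I J = ideal_mul J I.
Proof.
suff sub A B : ideal_mul A B `<=` ideal_mul B A by apply/seteqP; split.
move=> x [n [u [v [Au Bv ->]]]]; exists n, v, u; split=> //.
by apply: eq_bigr => i _; rewrite mulrC.
Qed.

Fact ag_adj_sym I J : ag_adj I J -> ag_adj J I.
Proof.
by move=> [IJ IJ0]; split; [move=> JI; apply: IJ | rewrite ideal_mulC].
Qed.

Fact ag_adj_irrefl I : ~ ag_adj I I.
Proof. by case=> ne _; apply: ne. Qed.

Definition annihilating_ideal_graph : sgraph :=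
  SGraph ag_adj_sym ag_adj_irrefl.

End AnnihilatingIdealGraph.

(* Main.v *)
Require Import Defs.
From mathcomp Require Import all_boot all_algebra all_classical.

(** Suppose AG(R) is a K_n(2) with n >= 3.  Let A and B be the clique vertices
    that carry the horns, C a third clique vertex, X a leaf at A and Y a leaf at
    B.  A nonzero ideal that annihilates a leaf is that leaf or its unique
    neighbour; this makes B a minimal ideal, since a nonzero ideal inside B
    annihilates Y.  The third vertex C forces A ^ 2 = 0: the ideal A + B
    annihilates C, hence lies in the clique, so it annihilates A or equals A;
    the latter would put B inside A, whereas X annihilates A but not B.
    Exchanging the two horns gives B ^ 2 = 0.

    Since X B <> 0 and B is minimal, some x in X fixes a nonzero b of B, while x
    annihilates A.  Thus 1 - x annihilates B and fixes A: x and 1 - x, together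
    with all their powers, behave like opposite leaves, and a leaf at A never
    annihilates a leaf at B.  Hence z = x (1 - x) is not nilpotent
    ([mul_leaves_neq0]).  But z annihilates both A and B, so zR and (z ^ 2)R
    are clique vertices; were they distinct, z ^ 3 would be 0.  So z = r z ^ 2
    for some r.  Then zR is a clique vertex other than A and B, and its
    neighbour (1 - r z)R must lie in the clique.  All clique vertices annihilate
    A, including A itself as A ^ 2 = 0, whereas 1 - r z fixes A. *)

Set Implicit Arguments.
Unset Strict Implicit.
Unset Printing Implicit Defensive.

Import GRing.Theory.
Local Open Scope classical_set_scope.
Local Open Scope ring_scope.
Local Open Scope card_scope.

(** * The shape of a complete graph with two horns *)

(** The part of the structure of a complete graph with two horns that can be
    read off inside the graph itself, with [K] the set of clique vertices. *)
Record two_horned_clique (G : sgraph) (K : G -> Prop) (A B C X Y : G) : Prop :=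
  TwoHornedClique {
    clique_adj : forall U V, K U -> K V -> U <> V -> adj U V;
    clique_A : K A;
    clique_B : K B;
    clique_C : K C;
    base_neq : A <> B;
    third_neqA : C <> A;
    third_neqB : C <> B;
    leaf_X : ~ K X;
    leaf_Y : ~ K Y;
    adj_XA : adj X A;
    adj_YB : adj Y B;
    leaf_adjA : forall V W, ~ K V -> adj V A -> adj V W -> W = A;
    leaf_adjB : forall V W, ~ K V -> adj V B -> adj V W -> W = B;
    hornless_adj : forall U V, K U -> U <> A -> U <> B -> adj U V -> K V
  }.

Lemma two_horned_clique_sym (G : sgraph) (K : G -> Prop) (A B C X Y : G) :
  two_horned_clique K A B C X Y -> two_horned_clique K B A C Y X.
Proof.
case=> KK KA KB KC AB CA CB KX KY XA YB leafA leafB hornless.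
split=> //; first by move=> BA; apply: AB.
by move=> U V KU UB UA; apply: hornless.
Qed.

Lemma third_element (N : Type) (a b : N) :
  ([set: 'I_3] #<= [set: N])%card -> exists c : N, c <> a /\ c <> b.
Proof.
move=> /card_leP[g]; pose f (i : 'I_3) : N := val (g (to_setT i)).
have finj (i j : 'I_3) : f i = f j -> i = j.
  by move=> /val_inj /(inj (mem_set I) (mem_set I)) /(congr1 val).
pose i0 := inord 0 : 'I_3; pose i1 := inord 1 : 'I_3; pose i2 := inord 2 : 'I_3.
have n01 : i0 <> i1 by move/(congr1 val); rewrite /= !inordK.
have n02 : i0 <> i2 by move/(congr1 val); rewrite /= !inordK.
have n12 : i1 <> i2 by move/(congr1 val); rewrite /= !inordK.
apply: contrapT => nex.
have ab (i : 'I_3) : f i = a \/ f i = b.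
  by apply: contrapT => /not_orP[ia ib]; apply: nex; exists (f i).
case: (ab i0) (ab i1) (ab i2) => h0 [] h1 [] h2;
  solve [ by apply: n01; apply: finj; rewrite h0 h1
        | by apply: n02; apply: finj; rewrite h0 h2
        | by apply: n12; apply: finj; rewrite h1 h2 ].
Qed.

Lemma complete_2horns_clique (N : Type) (G : sgraph) :
  ([set: 'I_3] #<= [set: N])%card -> is_complete_2horns N G ->
  exists (K : G -> Prop) (A B C X Y : G), two_horned_clique K A B C X Y.
Proof.
move=> N3 [a [b [H1 [H2 [ab [h1] [h2] [f [g fK gK] fadj]]]]]].
have [c [ca cb]] := third_element a b N3.
have finj U V : f U = f V -> U = V by move=> /(congr1 g); rewrite !fK.
have ginj u v : g u = g v -> u = v by move=> /(congr1 f); rewrite !gK.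
exists (fun U => exists n : N, f U = inl (inl n)).
exists (g (inl (inl a))), (g (inl (inl b))), (g (inl (inl c))),
  (g (inl (inr h1))), (g (inr h2)).
split.
- move=> U V [m fU] [n fV] UV; apply/fadj; rewrite fU fV /= => mn.
  by apply: UV; apply: finj; rewrite fU fV mn.
- by exists a; rewrite gK.
- by exists b; rewrite gK.
- by exists c; rewrite gK.
- by move/ginj => -[].
- by move/ginj => -[].
- by move/ginj => -[].
- by case=> n; rewrite gK.
- by case=> n; rewrite gK.
- by apply/fadj; rewrite !gK.
- by apply/fadj; rewrite !gK.
- move=> V W KV /fadj + /fadj; rewrite gK => VA VW.
  apply: finj; rewrite gK; move: KV VA VW.
  case: (f V) => [[m|k]|k]; case: (f W) => [[n|l]|l] //= KV;
    first [ by case: KV; exists m | by move=> _ -> | by move=> _ [] | by case=> /ab ].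
- move=> V W KV /fadj + /fadj; rewrite gK => VA VW.
  apply: finj; rewrite gK; move: KV VA VW.
  case: (f V) => [[m|k]|k]; case: (f W) => [[n|l]|l] //= KV;
    first [ by case: KV; exists m | by move=> _ -> | by move=> /esym/ab ].
- move=> U V [n fU] UA UB /fadj; rewrite fU.
  have na : n <> a by move=> na; apply: UA; apply: finj; rewrite gK fU na.
  have nb : n <> b by move=> nb; apply: UB; apply: finj; rewrite gK fU nb.
  case: (f V) => [[m|k]|k] //=; first by exists m.
  by case=> /nb.
Qed.

(** * Vertices of the annihilating-ideal graph *)

Section Vertices.
Variable R : comPzRingType.
Implicit Types (I J : set R) (U V W : ag_vertex R) (x y z : R).

Lemma ideal_mul_eq0 I J :
  ideal_mul I J = [set 0] <-> (forall x y, I x -> J y -> x * y = 0).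
Proof.
split=> [IJ0 x y Ix Jy|IJ0].
  suff : ideal_mul I J (x * y) by rewrite IJ0.
  by exists 1%N, (fun=> x), (fun=> y); split=> //; rewrite big_ord1.
apply/seteqP; split=> [_ [n [u [v [Iu Jv ->]]]]|_ ->].
  by rewrite /= big1 // => i _; apply: IJ0.
by exists 0%N, (fun=> 0), (fun=> 0); split=> [[]|[]|] //; rewrite big_ord0.
Qed.

Lemma vertex_eq U V : sval U = sval V -> U = V.
Proof.
case: U V => [I pI] [J pJ] /= IJ; rewrite IJ in pI *.
by congr exist; apply: Prop_irrelevance.
Qed.

Lemma vertex_adj U V :
  U <> V -> (forall x y, sval U x -> sval V y -> x * y = 0) ->
  ag_adj U V.
Proof. by move=> UV UV0; split=> //; apply/ideal_mul_eq0. Qed.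

Lemma adj_mul0 U V x y : ag_adj U V -> sval U x -> sval V y -> x * y = 0.
Proof. by case=> _ /ideal_mul_eq0; apply. Qed.

Lemma vertexZ U r x : sval U x -> sval U (r * x).
Proof. by case: U => I [] /= [[_ _ IZ] _] _; apply: IZ. Qed.

Lemma vertex0 U : sval U 0.
Proof. by case: U => I [] /= [[I0 _ _] _] _. Qed.

Lemma vertexD U x y : sval U x -> sval U y -> sval U (x + y).
Proof. by case: U => I [] /= [[_ ID _] _] _; apply: ID. Qed.

Lemma nonzero_idealP I : is_ideal I -> nonzero_ideal I <-> exists2 x, I x & x <> 0.
Proof.
move=> Iid; split=> [[_ In0]|[x Ix x0]]; last first.
  by split=> // I0; move: Ix; rewrite I0.
apply: contrapT => nex; apply: In0; apply/seteqP; split=> [x Ix|_ ->].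
  by apply: contrapT => x0; apply: nex; exists x.
by case: Iid.
Qed.

Lemma vertex_neq0 U : exists2 x, sval U x & x <> 0.
Proof.
by case: U => I [] /= nzI _; apply/(nonzero_idealP nzI.1).
Qed.

Definition principal x : set R := [set y | exists r, y = r * x].

Lemma principal_id x : principal x x.
Proof. by exists 1; rewrite mul1r. Qed.

Lemma principal_ideal x : is_ideal (principal x).
Proof.
split; first by exists 0; rewrite mul0r.
- by move=> _ _ [r ->] [s ->]; exists (r + s); rewrite mulrDl.
- by move=> r _ [s ->]; exists (r * s); rewrite mulrA.
Qed.

Lemma nonzero_principal x : x <> 0 -> nonzero_ideal (principal x).
Proof.
move=> x0; apply/nonzero_idealP; first exact: principal_ideal.
by exists x => //; apply: principal_id.
Qed.

Lemma vertex_of_ideal I J :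
  nonzero_ideal I -> nonzero_ideal J -> ideal_mul I J = [set 0] ->
  exists U : ag_vertex R, sval U = I.
Proof.
move=> nzI nzJ IJ0.
have IV : nonzero_ideal I /\ exists J, nonzero_ideal J /\ ideal_mul I J = [set 0].
  by split=> //; exists J.
by exists (exist _ I IV : ag_vertex R).
Qed.

Lemma principal_vertex x y :
  x <> 0 -> y <> 0 -> x * y = 0 -> exists U : ag_vertex R, sval U = principal x.
Proof.
move=> x0 y0 xy0.
apply: (vertex_of_ideal (nonzero_principal x0) (nonzero_principal y0)).
apply/ideal_mul_eq0 => _ _ [r ->] [s ->].
by rewrite mulrACA xy0 mulr0.
Qed.

(** The sum of two vertices is a vertex as soon as they have a common
    annihilator; in general it may be faithful. *)
Lemma sum_vertex U V W :
  ag_adj U W -> ag_adj V W ->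
  exists S : ag_vertex R,
    sval S = [set x | exists u v, [/\ sval U u, sval V v & x = u + v]].
Proof.
move=> UW VW; set I := [set x | _].
have nzW : nonzero_ideal (sval W) by case: W {UW VW} => J [].
apply: (vertex_of_ideal _ nzW).
  apply/nonzero_idealP.
    split.
    - by exists 0, 0; split; rewrite ?addr0 //; apply: vertex0.
    - move=> _ _ [u [v [Uu Vv ->]]] [u' [v' [Uu' Vv' ->]]].
      exists (u + u'), (v + v'); split; [exact: vertexD|exact: vertexD|].
      by rewrite addrACA.
    - move=> r _ [u [v [Uu Vv ->]]]; exists (r * u), (r * v).
      by split; [exact: vertexZ|exact: vertexZ|rewrite mulrDr].
  have [u Uu u0] := vertex_neq0 U.
  by exists u => //; exists u, 0; split; rewrite ?addr0 //; apply: vertex0.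
apply/ideal_mul_eq0 => _ w [u [v [Uu Vv ->]]] Ww.
by rewrite mulrDl (adj_mul0 UW) // (adj_mul0 VW) // addr0.
Qed.

End Vertices.

(** * Rings whose annihilating-ideal graph is a two-horned clique *)

Section BaseVertex.
Variables (R : comPzRingType).
Notation G := (annihilating_ideal_graph R).
Variables (K : G -> Prop) (A B C X Y : G).
Hypothesis KG : two_horned_clique K A B C X Y.

Lemma base_mul0 a b : sval A a -> sval B b -> a * b = 0.
Proof.
apply: adj_mul0.
by apply: (clique_adj KG); [exact: clique_A KG|exact: clique_B KG|exact: base_neq KG].
Qed.

Lemma leaf_opposite_base : exists x b, [/\ sval X x, sval B b & x * b <> 0].
Proof.
apply: contrapT => nex; apply: (base_neq KG); apply/esym.
apply: (leaf_adjA KG (leaf_X KG) (adj_XA KG)); apply: vertex_adj.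
  by move=> XB; apply: (leaf_X KG); rewrite XB; apply: clique_B KG.
move=> x b Xx Bb; apply: contrapT => xb0; apply: nex.
by exists x, b.
Qed.

(** The sum [A + B] annihilates the hornless vertex [C], hence is in the clique;
    it is not [A], because [X] annihilates [A] but not [B]. *)
Lemma base_square0 a a' : sval A a -> sval A a' -> a * a' = 0.
Proof.
move=> Aa Aa'.
have AC : adj A C.
  apply: (clique_adj KG); [exact: clique_A KG|exact: clique_C KG|].
  by move=> AC; apply: (third_neqA KG).
have BC : adj B C.
  apply: (clique_adj KG); [exact: clique_B KG|exact: clique_C KG|].
  by move=> BC; apply: (third_neqB KG).
have [S S_AB] := sum_vertex AC BC.
have subA t : sval A t -> sval S t.
  by move=> At; rewrite S_AB; exists t, 0; split; rewrite ?addr0 //; apply: vertex0.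
have subB t : sval B t -> sval S t.
  by move=> Bt; rewrite S_AB; exists 0, t; split; rewrite ?add0r //; apply: vertex0.
have SA : (S : G) <> A.
  move=> SA; have [x [b [Xx Bb []]]] := leaf_opposite_base.
  by apply: (adj_mul0 (adj_XA KG)) => //; rewrite -SA; apply: subB.
have [CS|CS] := EM (C = S :> G).
  by rewrite mulrC; apply: (adj_mul0 AC) => //; rewrite CS; apply: subA.
have KS : K S.
  apply: (hornless_adj KG (clique_C KG) (third_neqA KG) (third_neqB KG)).
  apply: vertex_adj CS _ => c t Cc; rewrite S_AB => -[u [v [Au Bv ->]]].
  by rewrite mulrC mulrDl (adj_mul0 AC) // (adj_mul0 BC) // addr0.
have adjSA := clique_adj KG KS (clique_A KG) SA.
by apply: (adj_mul0 adjSA) => //; apply: subA.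
Qed.

End BaseVertex.

Section Contradiction.
Variables (R : comPzRingType).
Notation G := (annihilating_ideal_graph R).
Variables (K : G -> Prop) (A B C X Y : G).
Hypothesis KG : two_horned_clique K A B C X Y.

(** [B] is a minimal ideal: a principal ideal inside it annihilates the leaf
    [Y], so it is [B] or [Y], and [Y] does not annihilate [A]. *)
Lemma baseB_minimal b : sval B b -> b <> 0 -> sval B = principal b.
Proof.
move=> Bb b0; have [a Aa a0] := vertex_neq0 A.
have [V V_b] : exists V : G, sval V = principal b.
  apply: principal_vertex b0 a0 _.
  by rewrite mulrC; apply: (base_mul0 KG).
have [y [a' [Yy Aa' ya0]]] := leaf_opposite_base (two_horned_clique_sym KG).
rewrite -V_b; congr sval; apply/esym.
apply: (leaf_adjB KG (leaf_Y KG) (adj_YB KG)); apply: vertex_adj => [YV|].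
  move: Yy ya0; rewrite YV V_b => -[r ->] []; rewrite -mulrA.
  by rewrite [b * _]mulrC (base_mul0 KG Aa' Bb) mulr0.
move=> t u Yt; rewrite V_b => -[r ->].
by rewrite mulrCA (adj_mul0 (adj_YB KG) Yt Bb) mulr0.
Qed.

(** An element annihilating a nonzero [b] of [B] but not [A] generates a leaf
    at [B]: it is outside the clique because [A] is annihilated by every clique
    vertex, itself included.  A nonzero ideal annihilating that leaf is [B] or
    the leaf, and both annihilate [b], since [B] squares to zero. *)
Lemma mul_leaves_neq0 a b v w : sval A a -> sval B b ->
  v * a <> 0 -> v * b = 0 -> w * b <> 0 -> w * v <> 0.
Proof.
move=> Aa Bb va0 vb0 wb0 wv0.
have b0 : b <> 0 by move=> b0; apply: wb0; rewrite b0 mulr0.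
have w0 : w <> 0 by move=> w0; apply: wb0; rewrite w0 mul0r.
have v0 : v <> 0 by move=> v0; apply: va0; rewrite v0 mul0r.
have [V V_v] : exists V : G, sval V = principal v by apply: principal_vertex v0 b0 _.
have [W W_w] : exists W : G, sval W = principal w by apply: principal_vertex w0 v0 _.
have Vv : sval V v by rewrite V_v; apply: principal_id.
have Ww : sval W w by rewrite W_w; apply: principal_id.
have KV : ~ K V.
  move=> KV; have [VA|VA] := EM (V = A).
    by apply: va0; apply: (base_square0 KG) Aa; rewrite -VA.
  by apply: va0; apply: (adj_mul0 (clique_adj KG KV (clique_A KG) VA)).
have VB : adj V B.
  apply: vertex_adj => [VB|].
    by apply: KV; rewrite VB; apply: clique_B KG.
  move=> v' b'; rewrite V_v (baseB_minimal Bb b0) => -[r ->] [s ->].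
  by rewrite mulrACA vb0 mulr0.
have VW : adj V W.
  apply: vertex_adj => [VW|].
    apply: wb0; move: Ww; rewrite -VW V_v => -[r ->].
    by rewrite -mulrA vb0 mulr0.
  move=> p q; rewrite V_v W_w => -[r ->] [s ->].
  by rewrite mulrACA [v * w]mulrC wv0 mulr0.
apply: wb0; apply: (base_square0 (two_horned_clique_sym KG)) => //.
by rewrite -(leaf_adjB KG KV VB VW).
Qed.

(** A leaf has a single neighbour, so it cannot annihilate both [A] and [B].
    The condition on [w * w] keeps [V] away from [A] and [B], all of whose
    elements are annihilated by [w]. *)
Lemma annihilates_bases_clique w (V : G) : sval V = principal w ->
  (forall t, sval A t -> w * t = 0) -> (forall t, sval B t -> w * t = 0) ->
  w * w <> 0 -> [/\ K V, V <> A & V <> B].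
Proof.
move=> V_w wA wB w2; have Vw : sval V w by rewrite V_w; apply: principal_id.
have VA : V <> A by move=> VA; apply: w2; apply: wA; rewrite -VA.
have VB : V <> B by move=> VB; apply: w2; apply: wB; rewrite -VB.
split=> //; apply: contrapT => KV; apply: (base_neq KG); apply/esym.
apply: (leaf_adjA KG KV); apply: vertex_adj => // v t; rewrite V_w => -[r ->] Ut.
  by rewrite -mulrA (wA _ Ut) mulr0.
by rewrite -mulrA (wB _ Ut) mulr0.
Qed.

Lemma no_two_horned_clique : False.
Proof.
have [x0 [b0 [Xx0 Bb0 xb0]]] := leaf_opposite_base KG.
have [a Aa a0] := vertex_neq0 A.
(* B is generated by x0 b0, so a multiple x of x0 fixes b0. *)
have [x [Xx xb]] : exists x, sval X x /\ x * b0 = b0.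
  have [r b0E] : principal (x0 * b0) b0.
    by rewrite -(@baseB_minimal (x0 * b0)) //; apply: vertexZ.
  by exists (r * x0); split; [exact: vertexZ|rewrite -mulrA].
pose z := x * (1 - x).
have nzb : b0 <> 0 by move=> b00; apply: xb0; rewrite b00 mulr0.
have xA t : sval A t -> x * t = 0 by apply: (adj_mul0 (adj_XA KG)).
have x'b : (1 - x) * b0 = 0 by rewrite mulrBl mul1r xb subrr.
have x'a : (1 - x) * a = a by rewrite mulrBl mul1r xA // subr0.
have powM y t : y * t = t -> forall n, y ^+ n * t = t.
  by move=> yt; elim=> [|n IH]; rewrite ?mul1r // exprSr -mulrA yt.
have zn n : z ^+ n.+1 <> 0.
  rewrite exprMn; apply: (mul_leaves_neq0 Aa Bb0).
  - by rewrite powM.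
  - by rewrite exprSr -mulrA x'b mulr0.
  - by rewrite powM.
have zA t : sval A t -> z * t = 0.
  by move=> At; rewrite /z mulrAC xA ?mul0r.
have zB t : sval B t -> z * t = 0.
  rewrite (baseB_minimal Bb0 nzb) => -[s ->].
  by rewrite /z mulrCA -mulrA x'b !mulr0.
clearbody z.
have z0 : z <> 0 by move: (zn 0); rewrite expr1.
have z2 : z * z <> 0 by rewrite -expr2; apply: zn.
have [D D_z] : exists D : G, sval D = principal z.
  by apply: (principal_vertex z0 a0); apply: zA.
have [E E_z] : exists E : G, sval E = principal (z * z).
  by apply: (principal_vertex z2 a0); rewrite -mulrA (zA _ Aa) mulr0.
have [KD DA DB] := annihilates_bases_clique D_z zA zB z2.
have [KE _ _] : [/\ K E, E <> A & E <> B].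
  apply: (annihilates_bases_clique E_z) => [t At|t Bt|].
  - by rewrite -mulrA (zA _ At) mulr0.
  - by rewrite -mulrA (zB _ Bt) mulr0.
  - by rewrite -!expr2 -exprM; apply: zn.
have Dz : sval D z by rewrite D_z; apply: principal_id.
(* Distinct clique vertices zR and (z z)R would be adjacent, making z ^ 3 zero. *)
have [q zE] : exists q, z = q * (z * z).
  have DE : D = E.
    apply: contrapT => DE; apply: (zn 2); rewrite !exprS expr0 mulr1.
    apply: (adj_mul0 (clique_adj KG KD KE DE)) => //.
    by rewrite E_z; apply: principal_id.
  by move: Dz; rewrite DE E_z.
(* u annihilates the hornless clique vertex zR, so uR falls in the clique; but
   u fixes a, which every clique vertex annihilates. *)
pose u := 1 - q * z.
have uz : u * z = 0 by rewrite mulrBl mul1r -mulrA -zE subrr.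
have ua : u * a = a by rewrite mulrBl mul1r -mulrA (zA _ Aa) mulr0 subr0.
have u0 : u <> 0 by move=> u0; apply: a0; rewrite -ua u0 mul0r.
have [U U_u] : exists U : G, sval U = principal u by apply: principal_vertex u0 z0 uz.
have Uu : sval U u by rewrite U_u; apply: principal_id.
have KU : K U.
  apply: (hornless_adj KG KD DA DB); apply: vertex_adj => [DU|].
    move: Dz; rewrite DU U_u => -[s zs]; apply: z2.
    by rewrite {1}zs -mulrA uz mulr0.
  move=> p p'; rewrite D_z U_u => -[s ->] [t ->].
  by rewrite mulrACA [z * u]mulrC uz mulr0.
apply: a0; rewrite -ua.
have [UA|UA] := EM (U = A); first by apply: (base_square0 KG) => //; rewrite -UA.
exact: adj_mul0 (clique_adj KG KU (clique_A KG) UA) _ _.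
Qed.

End Contradiction.

Theorem theorem4p6 :
  ~ exists (R : comPzRingType) (N : Type),
      [set: 'I_3] #<= [set: N] /\
      is_complete_2horns N (annihilating_ideal_graph R).
Proof.
case=> R [N [N3 KN]].
have [K [A [B [C [X [Y KG]]]]]] := complete_2horns_clique N3 KN.
exact: no_two_horned_clique KG.
Qed.
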